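(* Let $m,n$ be positive integers and $A\in\mathcal{M}_{n,m}(\mathbb{F}_q((z^{-1})))$. Then the set $\mathrm{Bad}(A)$ has Hausdorff dimension $n$. More precisely, there exists a continuous function $f:\mathbb{R}_+\to\mathbb{R}_+$ with $f(0)=0$ such that the Hausdorff dimension of $\mathrm{Bad}^{\varepsilon}(A)$ is at least $n-f(\varepsilon)$ for every positive $\varepsilon\le q^{-\frac{m}{n}-6}$.
   Context: Let $q$ be a prime power, $\mathbb{F}_q[z]$ the polynomial ring over the field $\mathbb{F}_q$ with $q$ elements and $\mathbb{F}_q((z^{-1}))$ the field of formal Laurent series in $z^{-1}$. For nonzero $x$, $\|x\|=q^{\deg x}$ ($\deg x$ being the largest $d$ with nonzero coefficient of $z^d$), $\|0\|=0$. For vectors, $\|\underline{v}\|$ is the maximum norm of the coordinates and $|\langle\underline{v}\rangle|=\min_{\underline{y}\text{ polynomial vector}}\|\underline{v}-\underline{y}\|$. Let $\mathbb{I}=\{x:\|x\|<1\}$. For $\varepsilon>0$, $$\mathrm{Bad}^{\varepsilon}(A)=\Big\{\underline{\theta}\in\mathbb{I}^n:\ \liminf_{\underline{x}\in\mathbb{F}_q[z]^m,\ \|\underline{x}\|\to\infty}\|\underline{x}\|^{m/n}\,|\langle A\underline{x}-\underline{\theta}\rangle|\ge\varepsilon\Big\},\qquad \mathrm{Bad}(A)=\bigcup_{\varepsilon>0}\mathrm{Bad}^{\varepsilon}(A).$$ Hausdorff dimension is taken with respect to the ultrametric $d(\underline{x},\underline{y})=\|\underline{x}-\underline{y}\|$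 on $\mathbb{I}^n$. *)

(* Defs.v *)
From HB Require Import structures.
From mathcomp Require Import all_boot all_order all_algebra.
From mathcomp Require Import zify finmap.
From mathcomp Require Import all_classical all_reals all_analysis.

Set Implicit Arguments.
Unset Strict Implicit.
Unset Printing Implicit Defensive.

Import Order.TTheory GRing.Theory Num.Theory.
Import numFieldNormedType.Exports.

Local Open Scope classical_set_scope.
Local Open Scope ring_scope.

(* F((z^-1)): [x k] is the coefficient of z^k, k ranging over all of int. *)
Record laurent (F : fieldType) := Laurent {
  lcoef :> int -> F;
  lcoef_bounded : exists N : int, forall k, N < k -> lcoef k = 0 }.

Section LaurentField.
Variable F : fieldType.
Implicit Types (x y w : laurent F) (N M : int).

HB.instance Definition _ := gen_eqMixin (laurent F).
HB.instance Definition _ := gen_choiceMixin (laurent F).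

Lemma laurentP x y : x =1 y -> x = y.
Proof.
case: x y => [f hf] [g hg] /= /funext fg; subst g.
by congr Laurent; exact: Prop_irrelevance.
Qed.

Definition deg_le N x := forall k, N < k -> x k = 0.

Lemma deg_le_trans N M x : N <= M -> deg_le N x -> deg_le M x.
Proof. by move=> NM xN k Mk; apply: xN; lia. Qed.

Lemma deg_le2 x y : exists N, deg_le N x /\ deg_le N y.
Proof.
have [N xN] := lcoef_bounded x; have [M yM] := lcoef_bounded y.
by exists (Num.max N M); split; [apply: deg_le_trans xN | apply: deg_le_trans yM]; lia.
Qed.

Lemma const_bounded (c : F) (d : int) :
  exists N : int, forall k, N < k -> (if k == d then c else 0) = 0.
Proof. by exists d => k dk; rewrite ifN//; lia. Qed.

Lemma add_bounded x y : exists N : int, forall k, N < k -> x k + y k = 0.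
Proof.
by have [N [xN yN]] := deg_le2 x y; exists N => k Nk; rewrite xN// yN// addr0.
Qed.

Lemma opp_bounded x : exists N : int, forall k, N < k -> - x k = 0.
Proof. by have [N xN] := lcoef_bounded x; exists N => k Nk; rewrite xN// oppr0. Qed.

Definition lmul_coef (f g : int -> F) (k : int) : F :=
  \sum_(i \in [set: int]) f i * g (k - i).

Lemma lmul_coef_eq0 N M x y k :
  deg_le N x -> deg_le M y -> N + M < k -> lmul_coef x y k = 0.
Proof.
move=> xN yM NMk; apply: fsbig1 => i _.
have [Ni|iN] := ltP N i; first by rewrite xN// mul0r.
by rewrite yM ?mulr0//; lia.
Qed.

Lemma mul_bounded x y : exists N : int, forall k, N < k -> lmul_coef x y k = 0.
Proof.
have [N [xN yN]] := deg_le2 x y.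
by exists (N + N) => k; apply: lmul_coef_eq0.
Qed.

Definition lzero : laurent F := Laurent (const_bounded 0 0).
Definition lone : laurent F := Laurent (const_bounded 1 0).
Definition ladd x y : laurent F := Laurent (add_bounded x y).
Definition lopp x : laurent F := Laurent (opp_bounded x).
Definition lmul x y : laurent F := Laurent (mul_bounded x y).

Fact laddA : associative ladd.
Proof. by move=> x y w; apply: laurentP => k /=; rewrite addrA. Qed.
Fact laddC : commutative ladd.
Proof. by move=> x y; apply: laurentP => k /=; rewrite addrC. Qed.
Fact ladd0 : left_id lzero ladd.
Proof. by move=> x; apply: laurentP => k /=; rewrite if_same add0r. Qed.
Fact laddN : left_inverse lzero lopp ladd.
Proof. by move=> x; apply: laurentP => k /=; rewrite if_same addNr. Qed.

HB.instance Definition _ := Algebra.isZmodule.Build (laurent F) laddA laddC ladd0 laddN.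

Lemma lcoef0 k : (0 : laurent F) k = 0.
Proof. exact: if_same. Qed.

Lemma lcoefD x y k : (x + y) k = x k + y k.
Proof. by []. Qed.

Lemma lcoefN x k : (- x) k = - x k.
Proof. by []. Qed.

Lemma lmul_coefE N M x y (s : nat) : deg_le N x -> deg_le M y ->
  lmul_coef x y (N + M - s%:Z) =
  \sum_(a < s.+1) x (N - a%:Z) * y (M - (s - a)%N%:Z).
Proof.
move=> xN yM; rewrite /lmul_coef.
rewrite -(big_mkord xpredT (fun a => x (N - a%:Z) * y (M - (s - a)%N%:Z))).
rewrite (fsbigE [seq N - a%:Z | a <- index_iota 0 s.+1])//; first last.
- move=> i _ ir; have [Ni|iN] := ltP N i; first by rewrite xN// mul0r.
  rewrite [y _]yM ?mulr0// ltNge; apply: contra ir => iM.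
  apply/mapP; exists `|N - i|%N; last by lia.
  by rewrite mem_index_iota; lia.
- by rewrite map_inj_uniq ?iota_uniq// => a b; lia.
rewrite big_map; under eq_bigl do rewrite in_setT.
rewrite big_nat_cond [RHS]big_nat_cond; apply: eq_bigr => a /andP[/andP[_ sa] _].
by congr (_ * y _); lia.
Qed.

Let tpoly N (t : nat) x : {poly F} := \poly_(a < t.+1) x (N - a%:Z).

Let tpolyE N t x a : (a <= t)%N -> (tpoly N t x)`_a = x (N - a%:Z).
Proof. by move=> at_; rewrite coef_poly ltnS at_. Qed.

Let lmul_tpoly N M x y (s t : nat) : deg_le N x -> deg_le M y -> (s <= t)%N ->
  lmul_coef x y (N + M - s%:Z) = (tpoly N t x * tpoly M t y)`_s.
Proof.
move=> xN yM st; rewrite (lmul_coefE _ xN yM) coefM; apply: eq_bigr => a _.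
by rewrite !tpolyE//; have := ltn_ord a; lia.
Qed.

Fact lmulC : commutative lmul.
Proof.
move=> x y; apply: laurentP => k /=; have [N [xN yN]] := deg_le2 x y.
have [Nk|kN] := ltP (N + N) k; first by rewrite !(lmul_coef_eq0 (N := N) (M := N)).
have [s ->] : exists s : nat, k = N + N - s%:Z.
  by exists `|(N + N - k)%R|%N; lia.
by rewrite !(lmul_tpoly (t := s) (N := N) (M := N))// mulrC.
Qed.

Fact lmulA : associative lmul.
Proof.
move=> x y w; apply: laurentP => k /=.
have [N1 [xN1 yN1]] := deg_le2 x y; have [N2 wN2] := lcoef_bounded w.
pose N := Num.max N1 N2.
have xN : deg_le N x by apply: deg_le_trans xN1; rewrite /N; lia.
have yN : deg_le N y by apply: deg_le_trans yN1; rewrite /N; lia.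
have wN : deg_le N w by apply: deg_le_trans wN2; rewrite /N; lia.
have xyN : deg_le (N + N) (lmul x y) by move=> j; apply: lmul_coef_eq0.
have ywN : deg_le (N + N) (lmul y w) by move=> j; apply: lmul_coef_eq0.
have [Nk|kN] := ltP (N + N + N) k.
  rewrite [LHS](lmul_coef_eq0 xN ywN); last by lia.
  by rewrite [RHS](lmul_coef_eq0 xyN wN).
have [s ->] : exists s : nat, k = N + N + N - s%:Z.
  by exists `|(N + N + N - k)%R|%N; lia.
rewrite [RHS](lmul_tpoly xyN wN (leqnn s)).
have -> : N + N + N = N + (N + N) by rewrite addrA.
rewrite [LHS](lmul_tpoly xN ywN (leqnn s)).
transitivity ((tpoly N s x * (tpoly N s y * tpoly N s w))`_s).
  rewrite [LHS]coefM [RHS]coefM; apply: eq_bigr => a _; congr (_ * _).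
  by rewrite tpolyE ?leq_subr// -(lmul_tpoly yN wN (leq_subr _ _)).
rewrite mulrA [LHS]coefM [RHS]coefM; apply: eq_bigr => a _; congr (_ * _).
have sa : (a <= s)%N by have := ltn_ord a.
by rewrite tpolyE// -(lmul_tpoly xN yN sa).
Qed.

Fact lmul1 : left_id lone lmul.
Proof.
move=> x; apply: laurentP => k /=; rewrite /lmul_coef.
rewrite (fsbigTE (fset1 (0 : int))); last first.
  by move=> i; rewrite inE => /negPf /= ->; rewrite mul0r.
by rewrite big_seq_fset1 /= mul1r subr0.
Qed.

Fact lmulDl : left_distributive lmul +%R.
Proof.
move=> x y w; apply: laurentP => k /=.
have [N1 [xN1 yN1]] := deg_le2 x y; have [N2 wN2] := lcoef_bounded w.
pose N := Num.max N1 N2.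
have xN : deg_le N x by apply: deg_le_trans xN1; rewrite /N; lia.
have yN : deg_le N y by apply: deg_le_trans yN1; rewrite /N; lia.
have wN : deg_le N w by apply: deg_le_trans wN2; rewrite /N; lia.
have xyN : deg_le N (x + y) by move=> j Nj; rewrite lcoefD xN// yN// addr0.
have [Nk|kN] := ltP (N + N) k.
  by rewrite (lmul_coef_eq0 xN wN Nk) (lmul_coef_eq0 yN wN Nk) (lmul_coef_eq0 xyN wN Nk) addr0.
have [s ->] : exists s : nat, k = N + N - s%:Z.
  by exists `|(N + N - k)%R|%N; lia.
rewrite (lmul_coefE s xN wN) (lmul_coefE s yN wN) (lmul_coefE s xyN wN).
rewrite -big_split; apply: eq_bigr => a _ /=.
by rewrite mulrDl.
Qed.

Fact lone_neq0 : lone != 0.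
Proof.
by apply/eqP => /(congr1 (fun x => lcoef x 0))/eqP; rewrite /= oner_eq0.
Qed.

HB.instance Definition _ := GRing.Zmodule_isComNzRing.Build (laurent F)
  lmulA lmulC lmul1 lmulDl lone_neq0.

Lemma lcoef1 k : (1 : laurent F) k = (k == 0)%:R.
Proof. by rewrite /=; case: eqP. Qed.

Lemma lcoefM x y k : (x * y) k = \sum_(i \in [set: int]) x i * y (k - i).
Proof. by []. Qed.

(* The index of the leading nonzero coefficient; unspecified for x = 0. *)
Definition ldeg x : int := xget 0 [set d | x d != 0 /\ deg_le d x].

Lemma ldegP x : x != 0 -> x (ldeg x) != 0 /\ deg_le (ldeg x) x.
Proof.
move=> x0; suff [d dP] : exists d, x d != 0 /\ deg_le d x.
  by rewrite /ldeg; case: xgetP => [e -> //|/(_ d)].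
have [N xN] := lcoef_bounded x.
have [s xs] : exists s : nat, x (N - s%:Z) != 0.
  apply: contrapT => /forallNP h; move/eqP: x0; apply; apply: laurentP => k.
  rewrite lcoef0; have [|kN] := ltP N k; first exact: xN.
  have /negP/negPn/eqP := h `|(N - k)%R|%N.
  by have -> : N - `|(N - k)%R|%N%:Z = k by lia.
have hex : exists s : nat, x (N - s%:Z) != 0 by exists s.
case: (ex_minnP hex) => t xt tmin.
exists (N - t%:Z); split=> // k tk; have [|kN] := ltP N k; first exact: xN.
apply/eqP; apply: contraLR isT => xk.
have := tmin `|(N - k)%R|%N.
have -> : N - `|(N - k)%R|%N%:Z = k by lia.
by move=> /(_ xk); lia.
Qed.

(* Coefficients of the inverse of z^d (c_0 + c_1 z^-1 + ...), c_0 != 0: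
   z^-d times the power series whose first t coefficients are [inv_seq c t]. *)
Fixpoint inv_seq (c : nat -> F) (t : nat) : seq F :=
  if t isn't u.+1 then [::] else
  let b := inv_seq c u in
  rcons b ((c 0%N)^-1 * ((u == 0)%:R - \sum_(j < u) c (u - j)%N * b`_j)).

Lemma size_inv_seq c t : size (inv_seq c t) = t.
Proof. by elim: t => //= t IH; rewrite size_rcons IH. Qed.

Definition inv_coef c (u : nat) : F := (inv_seq c u.+1)`_u.

Lemma nth_inv_seq c t j : (j < t)%N -> (inv_seq c t)`_j = inv_coef c j.
Proof.
elim: t => // t IH; rewrite ltnS leq_eqVlt => /predU1P[->//|jt].
by rewrite /= nth_rcons size_inv_seq jt IH.
Qed.

Lemma inv_coefE c u : c 0%N != 0 ->
  \sum_(j < u.+1) inv_coef c j * c (u - j)%N = (u == 0)%:R.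
Proof.
move=> c0; rewrite big_ord_recr /= subnn {2}/inv_coef /=.
rewrite nth_rcons size_inv_seq ltnn eqxx mulrC mulrA mulfV// mul1r.
rewrite [X in _ + (_ - X)](eq_bigr (fun j : 'I_u => inv_coef c j * c (u - j)%N)).
  by rewrite addrC subrK.
by move=> j _; rewrite nth_inv_seq// mulrC.
Qed.

Lemma inv_bounded x : exists N : int, forall k, N < k ->
  (if k <= - ldeg x
   then inv_coef (fun j => x (ldeg x - j%:Z)) `|(- ldeg x - k)%R|%N else 0) = 0.
Proof. by exists (- ldeg x) => k dk; rewrite ifN//; lia. Qed.

Definition linv x : laurent F := if x == 0 then 0 else Laurent (inv_bounded x).

Fact lmulVf x : x != 0 -> linv x * x = 1.
Proof.
move=> x0; have [xd xbd] := ldegP x0; rewrite /linv (negPf x0).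
set y := Laurent _; pose d := ldeg x.
have yd : deg_le (- d) y by move=> k dk /=; rewrite ifN//; rewrite /d in dk; lia.
apply: laurentP => k; rewrite lcoef1; have [k0|k0] := ltP 0 k.
  by rewrite [LHS](lmul_coef_eq0 yd xbd) ?addNr// gt_eqF.
have [s ->] : exists s : nat, k = - d + d - s%:Z by exists `|k|%N; lia.
rewrite [LHS](lmul_coefE s yd xbd) addNr sub0r oppr_eq0.
rewrite [RHS](_ : _ = (s == 0)%:R)//.
rewrite -(inv_coefE (c := fun j => x (d - j%:Z))) ?subr0//.
apply: eq_bigr => a _; congr (_ * _); rewrite /y /= -/d ifT; last by lia.
by congr (inv_coef _ _); lia.
Qed.

Fact linv0 : linv 0 = 0.
Proof. by rewrite /linv eqxx. Qed.

HB.instance Definition _ := GRing.ComNzRing_isField.Build (laurent F) lmulVf linv0.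

End LaurentField.

Section Norms.
Variables (R : realType) (F : finFieldType).
Implicit Types x : laurent F.

Definition lnorm x : R := if x == 0 then 0 else #|F|%:R ^ ldeg x.

Definition vnorm n (v : 'cV[laurent F]_n) : R :=
  \big[Num.max/0]_(i < n) lnorm (v i 0).

Definition vdist n (v w : 'cV[laurent F]_n) : R := vnorm (v - w).

Lemma poly_bounded (p : {poly F}) : exists N : int, forall k, N < k ->
  (if k is Posz i then p`_i else 0) = 0.
Proof.
exists (size p)%:Z => -[i|//]; rewrite ltz_nat => pi.
by rewrite nth_default// ltnW.
Qed.

Definition laurent_of_poly (p : {poly F}) : laurent F := Laurent (poly_bounded p).

Definition pvec n (y : 'cV[{poly F}]_n) : 'cV[laurent F]_n :=
  map_mx laurent_of_poly y.

(* This infimum is a minimum: see [dist_polyP]. *)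
Definition dist_poly n (v : 'cV[laurent F]_n) : R :=
  inf [set vnorm (v - pvec y) | y in [set: 'cV[{poly F}]_n]].

Lemma lnorm_ge0 x : 0 <= lnorm x.
Proof. by rewrite /lnorm; case: eqP => // _; rewrite exprz_ge0. Qed.

Lemma lnorm_coef x k : x k != 0 -> #|F|%:R ^ k <= lnorm x.
Proof.
move=> xk; rewrite /lnorm; case: eqVneq => [x0|x0].
  by rewrite x0 lcoef0 eqxx in xk.
have [_ xb] := ldegP x0; apply: ler_weXz2l.
  by rewrite ler1n; apply/card_gt0P; exists 0.
by rewrite leNgt; apply: contra xk => /xb ->.
Qed.

Lemma vnorm_le n (v w : 'cV[laurent F]_n) :
  (forall i, lnorm (v i 0) <= lnorm (w i 0)) -> vnorm v <= vnorm w.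
Proof.
move=> vw; rewrite /vnorm.
elim/big_ind2: _ => // a b c e ab ce.
by rewrite ge_max !le_max ab ce orbT.
Qed.

Lemma dist_polyP n (v : 'cV[laurent F]_n) :
  exists2 y, dist_poly v = vnorm (v - pvec y) &
             forall y', vnorm (v - pvec y) <= vnorm (v - pvec y').
Proof.
have h i : exists p : {poly F}, forall j : nat, p`_j = v i 0 j%:Z.
  have [N vN] := lcoef_bounded (v i 0).
  exists (\poly_(j < `|N|.+1) v i 0 j%:Z) => j; rewrite coef_poly.
  by case: ltnP => // Nj; rewrite vN//; lia.
pose y : 'cV[{poly F}]_n := \col_i projT1 (cid (h i)).
have ymin y' : vnorm (v - pvec y) <= vnorm (v - pvec y').
  apply: vnorm_le => i; rewrite !mxE; set f := v i 0 - _.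
  have [-> | f0] := eqVneq f 0; first by rewrite {1}/lnorm eqxx lnorm_ge0.
  rewrite {1}/lnorm (negPf f0); apply: lnorm_coef.
  have [fd _] := ldegP f0; move: fd; rewrite /f !lcoefD !lcoefN /=.
  case: (ldeg _) => [k|k] //=.
  by case: cid => p /= ->; rewrite subrr eqxx.
exists y => //; rewrite /dist_poly; set S := [set _ | _ in _].
have Sy : S (vnorm (v - pvec y)) by exists y.
have lbS : lbound S (vnorm (v - pvec y)) by move=> _ [y' _ <-].
apply/eqP; rewrite eq_le; apply/andP; split; last first.
  by apply: lb_le_inf => //; exists (vnorm (v - pvec y)).
by apply: ge_inf => //; exists (vnorm (v - pvec y)).
Qed.

End Norms.

Section Hausdorff.
Variables (R : realType) (T : Type) (d : T -> T -> R).
Implicit Types (E U : set T) (s delta : R).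
Local Open Scope ereal_scope.

Definition diam U : \bar R := ereal_sup [set (d x y)%:E | x in U & y in U].

(* diam(U)^s, the empty set counting for 0 also when s = 0, so that countable
   covers include the finite ones. *)
Definition hausdorff_gauge s U : \bar R := if U == set0 then 0 else diam U `^ s.

Definition hausdorff_content s delta E : \bar R :=
  ereal_inf [set \sum_(0 <= i <oo) hausdorff_gauge s (U i) |
    U in [set U : (set T)^nat | E `<=` \bigcup_i U i /\
                                forall i, diam (U i) <= delta%:E]].

(* The supremum is the limit as delta -> 0+, by monotonicity in delta. *)
Definition hausdorff_measure s E : \bar R :=
  ereal_sup [set hausdorff_content s delta E | delta in [set delta | (0 < delta)%R]].

Definition hausdorff_dim E : \bar R :=
  ereal_inf [set s%:E | s in [set s | (0 <= s)%R /\ hausdorff_measure s E = 0]].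

End Hausdorff.

Section BadlyApproximable.
Variables (R : realType) (F : finFieldType) (m n : nat).

(* liminf of u x as ||x|| -> +oo: sup over B of the infimum over ||x|| > B;
   extended-real valued as u need not be bounded. *)
Definition liminf_pvec (u : 'cV[{poly F}]_m -> R) : \bar R :=
  ereal_sup [set ereal_inf [set (u x)%:E | x in [set x | B < vnorm R (pvec x)]]
            | B in [set: R]].

Definition unit_cube : set 'cV[laurent F]_n :=
  [set theta | forall i, lnorm R (theta i 0) < 1].

Definition bad_eps (A : 'M[laurent F]_(n, m)) (eps : R) : set 'cV[laurent F]_n :=
  [set theta | unit_cube theta /\
    (eps%:E <= liminf_pvec (fun x =>
      (vnorm R (pvec x) `^ (m%:R / n%:R)
       * dist_poly R (A *m pvec x - theta))%R))%E].

Definition bad (A : 'M[laurent F]_(n, m)) : set 'cV[laurent F]_n :=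
  \bigcup_(eps in [set eps : R | 0 < eps]) bad_eps A eps.

End BadlyApproximable.

(* Main.v *)
(* The set is found by duality.  Fix L = m K and cut the degrees into windows
   [j L, (j+1) L); in each window take a polynomial vector y_j minimizing the distance of
   A^T y_j to polynomial vectors.  Dirichlet's theorem bounds these minima, so for every
   polynomial x some y_j of the right size makes A^T y_j.x almost polynomial.  If the
   coefficient of y_j.theta at z^-1 is 1 for all j, then A x - theta is far from all
   polynomial vectors: theta lies in Bad^eps(A) with eps = q^(-m/n - L).

   These conditions fix one of the n L digits of theta in every window.  A countable
   cover by cylinders of total mass less than 1 therefore misses a solution theta, found
   digit by digit: the conditional mass of the cover is at least its average over the
   admissible next digits, so some digit keeps it below 1.  As a cylinder of depth k has
   mass at most q^(1 - k (n - 1/L)), the dimension is at least n - 1/L.  Now let L grow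
   as eps tends to 0. *)
Require Import Defs.
From mathcomp Require Import all_boot all_order all_algebra.
From mathcomp Require Import all_classical all_reals all_analysis.
From mathcomp Require Import zify ring lra.
Set Implicit Arguments.
Unset Strict Implicit.
Unset Printing Implicit Defensive.
Import Order.TTheory GRing.Theory Num.Theory.
Import numFieldNormedType.Exports.
Local Open Scope classical_set_scope.
Local Open Scope ring_scope.

(** * Norm bounds as degree bounds, and coefficients of products *)

Section NormDegree.
Variables (R : realType) (F : finFieldType).
Implicit Types (x : laurent F) (N : int).

Local Notation q := (#|F|%:R : R).

Lemma card_field_gt1 : 1 < q.
Proof. by rewrite ltr1n card_finNzRing_gt1. Qed.

Lemma card_field_gt0 : 0 < q.
Proof. exact: lt_trans card_field_gt1. Qed.

(** Norms take only the values 0 and q^d, so a strict bound by a power of q says that coefficients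
    vanish. All norm estimates below pass through this equivalence. *)
Lemma lnorm_ltP x N : reflect (deg_le (N - 1) x) (lnorm R x < q ^ N).
Proof.
apply: (iffP idP) => [xN k Nk|xN].
  apply/eqP/negPn/negP => /(lnorm_coef R) xk.
  have := le_lt_trans xk xN; rewrite ltr_eXz2l ?card_field_gt1//; lia.
rewrite /lnorm; case: eqVneq => [_|x0]; first by rewrite exprz_gt0 ?card_field_gt0.
rewrite ltr_eXz2l ?card_field_gt1//.
have [xd _] := ldegP x0; rewrite ltNge; apply: contra xd => Nd.
by rewrite xN//; lia.
Qed.

Lemma vnorm_ltP n (v : 'cV[laurent F]_n) N :
  reflect (forall i, deg_le (N - 1) (v i 0)) (vnorm R v < q ^ N).
Proof.
have qN : 0 < q ^ N by rewrite exprz_gt0 ?card_field_gt0.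
apply: (iffP idP) => [vN i|vN].
  by apply/lnorm_ltP; apply: le_lt_trans vN; exact: le_bigmax.
by apply/bigmax_ltP; split => // i _; exact/lnorm_ltP.
Qed.

Lemma dist_poly_ltP n (v : 'cV[laurent F]_n) N :
  dist_poly R v < q ^ N <->
  exists y, forall i, deg_le (N - 1) ((v - pvec y) i 0).
Proof.
have [y -> ymin] := dist_polyP R v; split=> [/vnorm_ltP|[z /vnorm_ltP zN]].
  by exists y.
exact: le_lt_trans zN.
Qed.

Lemma vnorm_bounded n (v : 'cV[laurent F]_n) : exists e : nat, vnorm R v < q ^ e.+1.
Proof.
have h i : exists e : nat, deg_le e (v i 0).
  have [N vN] := lcoef_bounded (v i 0).
  by exists `|N|%N => k Nk; rewrite vN//; lia.
have [e he] := choice h; exists (\max_i e i); apply/vnorm_ltP => i.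
by apply: deg_le_trans (he i); have := leq_bigmax (F := e) i; lia.
Qed.

Lemma laurent_of_polyD (p r : {poly F}) :
  laurent_of_poly (p + r) = laurent_of_poly p + laurent_of_poly r.
Proof. by apply: laurentP => -[k|k]; rewrite lcoefD /= ?coefD ?addr0. Qed.

Lemma laurent_of_polyN (p : {poly F}) : laurent_of_poly (- p) = - laurent_of_poly p.
Proof. by apply: laurentP => -[k|k]; rewrite lcoefN /= ?coefN ?oppr0. Qed.

Lemma laurent_of_poly_deg (p : {poly F}) (d : nat) :
  (size p <= d.+1)%N -> deg_le d (laurent_of_poly p).
Proof. by move=> pd [k|//]; rewrite ltz_nat => dk /=; rewrite nth_default// (leq_trans pd). Qed.

Lemma pvecB n (y z : 'cV[{poly F}]_n) : pvec (y - z) = pvec y - pvec z.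
Proof.
by apply/matrixP => i j; rewrite !mxE laurent_of_polyD laurent_of_polyN.
Qed.

Lemma lcoef_sum (I : finType) (P : pred I) (f : I -> laurent F) k :
  (\sum_(i | P i) f i) k = \sum_(i | P i) f i k.
Proof.
by elim/big_rec2: _ => [|i a b _ <-]; rewrite ?lcoef0 ?lcoefD.
Qed.

Lemma deg_le_mul x y N M : deg_le N x -> deg_le M y -> deg_le (N + M) (x * y).
Proof. by move=> xN yM k; exact: lmul_coef_eq0. Qed.

Lemma deg_le_dot n (u : 'rV[laurent F]_n) (v : 'cV[laurent F]_n) N M :
  (forall i, deg_le N (u 0 i)) -> (forall i, deg_le M (v i 0)) ->
  deg_le (N + M) ((u *m v) 0 0).
Proof.
move=> uN vM k Nk; rewrite mxE lcoef_sum big1// => i _.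
exact: (deg_le_mul (uN i) (vM i)).
Qed.

(** [Negz k] is the exponent -(k+1); in particular [Negz 0] stands for z^-1, the coefficient on
    which the duality argument rests. *)
Lemma laurent_of_polyM_neg (p r : {poly F}) (k : nat) :
  (laurent_of_poly p * laurent_of_poly r) (Negz k) = 0.
Proof.
rewrite lcoefM; apply: fsbig1 => -[i|i] _; last by rewrite mul0r.
have -> : Negz k - Posz i = Negz (k + i) by lia.
by rewrite /= mulr0.
Qed.

Lemma pvec_dot_neg n (y z : 'cV[{poly F}]_n) (k : nat) :
  (((pvec y)^T *m pvec z) 0 0) (Negz k) = 0.
Proof.
by rewrite mxE lcoef_sum big1// => i _; rewrite !mxE; exact: laurent_of_polyM_neg.
Qed.

Lemma lcoef_poly_mul (p : {poly F}) x (d : nat) :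
  (size p <= d.+1)%N -> deg_le (Negz 0) x ->
  (laurent_of_poly p * x) (Negz 0) = \sum_(k < d.+1) p`_k * x (Negz k).
Proof.
move=> /laurent_of_poly_deg pd x1; rewrite mulrC.
have -> : Negz 0 = Negz 0 + d%:Z - d%:Z by lia.
rewrite [LHS](lmul_coefE d x1 pd); apply: eq_bigr => a _; rewrite mulrC.
have ad := ltn_ord a.
have -> : d%:Z - (d - a)%N%:Z = a%:Z by lia.
by have -> : Negz 0 - a%:Z = Negz a by lia.
Qed.

End NormDegree.

(** * Dirichlet's theorem and minimizers in degree windows *)

Section Dirichlet.
Variables (R : realType) (F : finFieldType) (m n : nat).
Variable A : 'M[laurent F]_(n, m).

Local Notation q := (#|F|%:R : R).

Lemma polynomial_part (x : laurent F) : exists p : {poly F}, forall j : nat, p`_j = x j.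
Proof.
have [N xN] := lcoef_bounded x.
exists (\poly_(j < `|N|.+1) x j%:Z) => j; rewrite coef_poly.
by case: ltnP => // Nj; rewrite xN//; lia.
Qed.

Definition vsize (y : 'cV[{poly F}]_n) : nat := \max_i size (y i 0%R).

Lemma vsize_leP (y : 'cV[{poly F}]_n) D :
  reflect (forall i, (size (y i 0%R) <= D)%N) (vsize y <= D)%N.
Proof. by apply: (iffP (bigop.bigmax_leqP _ _ _)) => h i *; exact: h. Qed.

Lemma vsize_gt0 (y : 'cV[{poly F}]_n) : y != 0 -> (0 < vsize y)%N.
Proof.
apply: contraNT; rewrite -leqNgt => /vsize_leP y0; apply/eqP/matrixP => i j.
by rewrite ord1 mxE; apply/eqP; rewrite -size_poly_leq0.
Qed.

(** Coefficient matrices make the vectors of size at most D a finite type, on which one can count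
    and minimize. *)
Definition cVpoly D (Y : 'M[F]_(n, D)) : 'cV[{poly F}]_n := \col_i rVpoly (row i Y).

Lemma vsize_cVpoly D (Y : 'M[F]_(n, D)) : (vsize (cVpoly Y) <= D)%N.
Proof. by apply/vsize_leP => i; rewrite mxE size_poly. Qed.

Lemma cVpoly_inj D : injective (@cVpoly D).
Proof.
move=> Y Z YZ; apply/row_matrixP => i.
by apply: (can_inj (@rVpolyK _ _)); move/matrixP/(_ i 0): YZ; rewrite !mxE.
Qed.

Lemma cVpoly_surj D (y : 'cV[{poly F}]_n) : (vsize y <= D)%N -> exists Y, @cVpoly D Y = y.
Proof.
move=> /vsize_leP yD; exists (\matrix_i poly_rV (y i 0)).
by apply/matrixP => i j; rewrite ord1 mxE rowK poly_rV_K.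
Qed.

Definition form_dist (y : 'cV[{poly F}]_n) : R := dist_poly R (A^T *m pvec y).

(** Pigeonhole: there are q^(n D) vectors of size at most D, but only q^(m b) possibilities for the
    first b fractional digits of A^T y. The difference of two vectors with the same digits is the
    solution. *)
Lemma dirichlet (D b : nat) : (m * b < n * D)%N ->
  exists y, [/\ y != 0, (vsize y <= D)%N & form_dist y < q ^ (- b%:Z)].
Proof.
move=> bD.
pose f (Y : 'M[F]_(n, D)) : 'M[F]_(m, b) :=
  \matrix_(k, l) (A^T *m pvec (cVpoly Y)) k 0 (Negz l).
have /injectivePn[Y [Z YZ fYZ]] : ~~ injectiveb f.
  apply/negP => /injectiveP/leq_card; rewrite !card_mx.
  by rewrite leq_exp2l ?card_finNzRing_gt1// leqNgt bD.
exists (cVpoly Y - cVpoly Z); split.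
- by rewrite subr_eq0; apply: contra YZ => /eqP/cVpoly_inj ->.
- apply/vsize_leP => i; rewrite !mxE (leq_trans (size_polyD _ _))// size_polyN.
  by rewrite geq_max !size_poly.
apply/dist_poly_ltP; rewrite pvecB mulmxBr.
set v := A^T *m pvec (cVpoly Y) - _.
have v0 k l : (l < b)%N -> v k 0 (Negz l) = 0.
  move=> lb; move/matrixP/(_ k (Ordinal lb)): fYZ; rewrite [LHS]mxE [RHS]mxE /= => fYZ.
  by rewrite [v k 0]mxE [X in _ + X]mxE lcoefD lcoefN fYZ subrr.
move: v v0 => v v0; have [g gP] := choice (fun k => polynomial_part (v k 0)).
exists (\col_k g k) => k -[l|l] bl; rewrite !mxE lcoefD lcoefN /=.
  by rewrite gP subrr.
by rewrite subr0 v0//; lia.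
Qed.

(** The window holds finitely many vectors, and it contains the one with all coordinates equal to
    X^D0. *)
Lemma window_minimizer (D0 D : nat) : (0 < n)%N -> (D0 < D)%N ->
  exists y, (D0 < vsize y <= D)%N /\
    forall z, (D0 < vsize z <= D)%N -> form_dist y <= form_dist z.
Proof.
move=> n0 D0D.
pose P (Y : 'M[F]_(n, D)) := (D0 < vsize (cVpoly Y))%N.
have [Y0 PY0] : exists Y, P Y.
  have : vsize (\col__ 'X^D0) = D0.+1.
    rewrite /vsize (eq_bigr (fun=> D0.+1)) => [|i _]; last by rewrite mxE size_polyXn.
    by rewrite big_const_ord; case: n n0 => // k _; elim: k => //= k ->; rewrite maxnn.
  move=> X0; have [|Y YX] := @cVpoly_surj D (\col__ 'X^D0); first by rewrite X0.
  by exists Y; rewrite /P YX X0.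
have [Y PY Ymin] := Order.TotalTheory.arg_minP (fun Y => form_dist (cVpoly Y)) PY0.
exists (cVpoly Y); split; first by rewrite [(_ < _)%N]PY vsize_cVpoly.
by move=> z /andP[z0 /cVpoly_surj[Z Zz]]; rewrite -Zz; apply: Ymin; rewrite /P Zz.
Qed.

(* Every Dirichlet solution lies in some window, whose minimizer does at least as well. *)
Lemma window_minimizers (L : nat) : (0 < n)%N -> (0 < L)%N ->
  exists y : nat -> 'cV[{poly F}]_n,
    (forall j, (j * L < vsize (y j) <= j.+1 * L)%N) /\
    forall j b, (m * b < n * (j.+1 * L))%N ->
      exists2 k, (k <= j)%N & form_dist (y k) < q ^ (- b%:Z).
Proof.
move=> n0 L0.
have h j : exists y, (j * L < vsize y <= j.+1 * L)%N /\
    forall z, (j * L < vsize z <= j.+1 * L)%N -> form_dist y <= form_dist z.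
  by apply: window_minimizer => //; rewrite ltn_mul2r L0 /=.
have [y yP] := choice h; exists y; split=> [j|j b bj]; first by case: (yP j).
have [z [z0 zD zb]] := dirichlet bj.
(* [(vsize z).-1] is the degree of z, and its quotient by L is the index of the window containing
   z. *)
have zs := vsize_gt0 z0; exists ((vsize z).-1 %/ L)%N.
  by rewrite -ltnS ltn_divLR//; case: (vsize z) zs zD.
apply: le_lt_trans zb; apply: (yP _).2.
have := divn_eq (vsize z).-1 L; have := ltn_pmod (vsize z).-1 L0; lia.
Qed.

End Dirichlet.

Arguments form_dist R {F m n} A y.

(** * Transference: from the dual conditions to bad approximability *)

Section Transference.
Variables (R : realType) (F : finFieldType) (m n : nat).
Variable A : 'M[laurent F]_(n, m).

Local Notation q := (#|F|%:R : R).

(* With w the fractional part of A^T y, one has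
   y.(A x - theta - p) = w.x - y.theta + (polynomial): if ||w|| ||x|| < 1/q, its
   coefficient at z^-1 is that of - y.theta. *)
Lemma dist_poly_ge (y : 'cV[{poly F}]_n) (x : 'cV[{poly F}]_m)
    (theta : 'cV[laurent F]_n) (D b e : nat) :
  ((pvec y)^T *m theta) 0 0 (Negz 0) = 1 -> (vsize y <= D)%N ->
  vnorm R (pvec x) < q ^ e.+1 -> form_dist R A y < q ^ (- b%:Z) -> (e < b)%N ->
  q ^ (- D%:Z) <= dist_poly R (A *m pvec x - theta).
Proof.
move=> y1 /vsize_leP yD /vnorm_ltP xe /dist_poly_ltP[g gb] eb; rewrite leNgt.
apply/negP => /dist_poly_ltP[p pD].
set v := A *m pvec x - theta - pvec p in pD.
set w := A^T *m pvec y - pvec g in gb.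
have vE : (pvec y)^T *m v =
    w^T *m pvec x + (pvec g)^T *m pvec x - (pvec y)^T *m theta - (pvec y)^T *m pvec p.
  rewrite -mulmxDl -linearD /= /w subrK /v !mulmxBr trmx_mul trmxK -mulmxA.
  by [].
(* Here y has degree below D and v has norm below q^(-D), so their product has degree at most -2. *)
have : ((pvec y)^T *m v) 0 0 (Negz 0) = 0.
  have yD' i : deg_le (D%:Z - 1) ((pvec y)^T 0 i).
    move=> [k|k] kD; rewrite !mxE//= nth_default// (leq_trans (yD i))//.
    by lia.
  by apply: (deg_le_dot yD' pD); lia.
have w0 : (w^T *m pvec x) 0 0 (Negz 0) = 0.
  have gb' i : deg_le (- b%:Z - 1) (w^T 0 i) by rewrite mxE.
  by apply: (deg_le_dot gb' xe); lia.
have cD (M1 M2 : 'M[laurent F]_1) :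
    (M1 + M2) 0 0 (Negz 0) = M1 0 0 (Negz 0) + M2 0 0 (Negz 0) by rewrite mxE.
have cN (M1 : 'M[laurent F]_1) : (- M1) 0 0 (Negz 0) = - M1 0 0 (Negz 0) by rewrite mxE.
rewrite vE !cD !cN y1 w0 !pvec_dot_neg addr0 sub0r subr0 => /eqP.
by rewrite oppr_eq0 oner_eq0.
Qed.

Definition dual_bad (y : nat -> 'cV[{poly F}]_n) : set 'cV[laurent F]_n :=
  [set theta | unit_cube R theta /\ forall j, ((pvec (y j))^T *m theta) 0 0 (Negz 0) = 1].

(** Let q^e <= ||x|| < q^(e+1) and j = (e+1) div nK. Some y_k with k <= j gives a distance of at
    least q^(-(j+1)mK), while j nK <= e+1 gives ||x||^(m/n) >= q^(j mK - m/n). In the product j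
    cancels. Window length mK for y thus matches length nK for the degree of x. *)
Lemma dual_bad_sub (y : nat -> 'cV[{poly F}]_n) (K : nat) :
  (0 < m)%N -> (0 < n)%N -> (0 < K)%N ->
  (forall j, (vsize (y j) <= j.+1 * (m * K))%N) ->
  (forall j b, (m * b < n * (j.+1 * (m * K)))%N ->
      exists2 k, (k <= j)%N & form_dist R A (y k) < q ^ (- b%:Z)) ->
  dual_bad y `<=` bad_eps A (q `^ (- (m%:R / n%:R) - (m * K)%:R)).
Proof.
move=> m0 n0 K0 ysize yb theta [cube y1]; split=> //.
(* The cutoff B = 1 in the liminf also supplies q^0 <= ||x|| in the case e = 0 below. *)
apply: le_trans (ereal_sup_ubound _); last by exists 1.
apply: le_ereal_inf_tmp => _ [x /= x1 <-]; rewrite lee_fin.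
have q0 := card_field_gt0 R F; have q1 := card_field_gt1 R F.
have hex := vnorm_bounded R (pvec x).
case: (ex_minnP hex) => e xe emin.
have qe : q ^ e <= vnorm R (pvec x).
  case: e xe emin => [_ _|e _ emin]; first exact: ltW.
  by rewrite leNgt; apply/negP => /emin; rewrite ltnn.
pose j := (e.+1 %/ (n * K))%N.
have nK0 : (0 < n * K)%N by rewrite muln_gt0 n0.
have jl : (j * (n * K) <= e.+1)%N by rewrite leq_divM.
have jr : (e.+1 < j.+1 * (n * K))%N by rewrite ltn_ceil.
(* The largest b with m b < n (j+1) mK; the strict bound e+1 < (j+1) nK leaves e < b. *)
pose b := (j.+1 * (n * K)).-1.
have [|k kj kb] := yb j b.
  have -> : (n * (j.+1 * (m * K)) = m * (j.+1 * (n * K)))%N by ring.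
  by rewrite ltn_pmul2l// /b prednK// muln_gt0.
have xb := dist_poly_ge (y1 k) (ysize k) xe kb.
have eb : (e < b)%N by rewrite /b; lia.
have {}xb := xb eb.
have qd : q ^ (- (j.+1 * (m * K))%N%:Z) <= dist_poly R (A *m pvec x - theta).
  apply: le_trans xb; rewrite ler_eXz2l// lerN2 lez_nat leq_mul2r ltnS kj.
  by rewrite orbT.
have n0' : 0 < n%:R :> R by rewrite ltr0n.
have mn0 : 0 <= m%:R / n%:R :> R by rewrite divr_ge0.
apply: le_trans (ler_pM _ _ (ge0_ler_powR mn0 _ _ qe) qd); rewrite ?powR_ge0 ?exprz_ge0 ?nnegrE ?(ltW q0)//;
  last exact: bigmax_ge_id.
rewrite -!powR_intmul ?(ltW q0)// -powRrM -powRD; last by rewrite (gt_eqF q0) implybT.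
apply: ler_powR; first exact: ltW.
have jlR : (j * (n * K))%:R <= e.+1%:R :> R by rewrite ler_nat.
have := ler_wpM2r mn0 jlR.
have -> : (j * (n * K))%:R * (m%:R / n%:R) = (j * (m * K))%:R :> R.
  by rewrite !natrM; field; rewrite gt_eqF.
rewrite -[e.+1]addn1 natrD mulrDl mul1r mulrNz.
have -> : (j.+1 * (m * K))%N%:~R = (j * (m * K))%:R + (m * K)%:R :> R.
  by rewrite mulSn addnC -natrD.
have -> : e%:~R = e%:R :> R by [].
lra.
Qed.

End Transference.

(** * A branch of a tree avoiding prefixes of small total mass *)

Section AvoidPrefixes.
Variables (R : realType) (V : finType) (c : nat -> nat).
Hypothesis c_gt0 : forall l, (0 < c l)%N.
Implicit Types (p w : seq V).

(* The probability that p lies on a random branch passing through w, when level l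
   has c l equally likely choices. *)
Definition mass p w : R :=
  if prefix p w then 1 else
  if prefix w p then (\prod_(size w <= l < size p) (c l)%:R)^-1 else 0.

Lemma mass_ge0 p w : 0 <= mass p w.
Proof.
by rewrite /mass; do 2![case: ifP => // _]; rewrite invr_ge0 prodr_ge0.
Qed.

Lemma mass_le1 p w : mass p w <= 1.
Proof.
rewrite /mass; do 2![case: ifP => // _]; rewrite invf_le1.
  by rewrite -natr_prod ler1n prodn_gt0.
by rewrite -natr_prod ltr0n prodn_gt0.
Qed.

(** If p is a prefix of w, each child has mass at most 1. If w is a proper prefix of p, only the
    child continuing towards p has mass, namely c(|w|) times that of w, and c(|w|) <= |S|. Otherwise
    every child has mass 0. *)
Lemma mass_step (S : {set V}) p w : (c (size w) <= #|S|)%N ->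
  \sum_(a in S) mass p (rcons w a) <= #|S|%:R * mass p w.
Proof.
move=> cS; have [pw|pw] := boolP (prefix p w).
  rewrite [X in _ * X]/mass pw mulr1 -sum1_card natr_sum.
  by apply: ler_sum => a _; exact: mass_le1.
have [/prefixP[[|b t] ptw]|wp] := boolP (prefix w p).
- by rewrite ptw cats0 prefix_refl in pw.
- have ca a : a != b -> mass p (rcons w a) = 0.
    move=> ab; rewrite /mass ptw.
    have /negPf -> : ~~ prefix (w ++ b :: t) (rcons w a).
      by rewrite -cats1 prefix_catr// eqxx prefix_cons eq_sym (negPf ab).
    by rewrite -cats1 prefix_catr// eqxx prefix_cons (negPf ab).
  have cb : mass p (rcons w b) = (c (size w))%:R * mass p w.
    rewrite /mass (negPf pw) ptw prefix_prefix.
    rewrite -cat_rcons prefix_prefix size_cat size_rcons.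
    have -> : (if prefix (rcons w b ++ t) (rcons w b) then 1 else
       (\prod_((size w).+1 <= l < (size w).+1 + size t) (c l)%:R)^-1) =
       (\prod_((size w).+1 <= l < (size w).+1 + size t) (c l)%:R)^-1 :> R.
      case: ifP => // /size_prefix; rewrite size_cat -{2}[size _]addn0 leq_add2l leqn0.
      by move=> /eqP ->; rewrite addn0 big_geq// invr1.
    rewrite [in RHS]big_ltn; last by rewrite addSn ltnS leq_addr.
    by rewrite invfM mulrA mulfV ?mul1r// pnatr_eq0 -lt0n.
  apply: (@le_trans _ _ (mass p (rcons w b))).
    rewrite (bigID (pred1 b)) /= [X in _ + X]big1 => [|a /andP[_ /ca]//].
    rewrite addr0; have [bS|bS] := boolP (b \in S).
      by rewrite (big_pred1 b)// => a /=; case: eqVneq => [->|_]; rewrite ?bS ?andbF.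
    rewrite big1 ?mass_ge0// => a /andP[aS /eqP ab].
    by rewrite -ab aS in bS.
  by rewrite cb ler_wpM2r ?mass_ge0 ?ler_nat.
- rewrite big1 ?mulr_ge0 ?mass_ge0// => a _; rewrite /mass.
  have /negPf -> : ~~ prefix p (rcons w a).
    apply/negP => /prefixP[s]; case/lastP: s => [|s x].
      by rewrite cats0 => pE; rewrite -pE prefix_rcons in wp.
    rewrite -rcons_cat => /rcons_inj[wE _].
    by rewrite wE prefix_prefix in pw.
  case: ifP => // /(prefix_trans (prefix_rcons w a)) wp'.
  by rewrite wp' in wp.
Qed.

Local Open Scope ereal_scope.

Variable (p : nat -> seq V).

Let total_mass w : \bar R := \sum_(0 <= i <oo) (mass (p i) w)%:E.

Let total_mass_step (S : {set V}) w : (c (size w) <= #|S|)%N ->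
  total_mass w < 1 -> exists2 a, a \in S & total_mass (rcons w a) < 1.
Proof.
move=> cS w1; apply: contrapT => noa.
have S0 : (0 < #|S|)%N by apply: leq_trans cS.
have : \sum_(a in S) total_mass (rcons w a) <= #|S|%:R%:E * total_mass w.
  rewrite /total_mass -nneseries_sum; last by move=> *; rewrite lee_fin mass_ge0.
  rewrite -nneseriesZl; last by move=> *; rewrite lee_fin mass_ge0.
  apply: lee_nneseries => [i _ _|i _].
    by apply: sume_ge0 => a _; rewrite lee_fin mass_ge0.
  by rewrite sumEFin -EFinM lee_fin mass_step.
apply/negP; rewrite -ltNge.
apply: (@lt_le_trans _ _ (#|S|%:R%:E)).
  by rewrite -[ltRHS]mule1 lte_pmul2l// lte_fin ltr0n.
rewrite -sum1_card natr_sum -sumEFin; apply: lee_sum => a aS.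
by rewrite leNgt; apply/negP => a1; apply: noa; exists a.
Qed.

(* Total mass is at least its average over the children, so it can be kept below 1
   along a branch. *)
Lemma avoid_prefixes (S : seq V -> {set V}) :
  (forall w, c (size w) <= #|S w|)%N ->
  \sum_(0 <= i <oo) ((\prod_(0 <= l < size (p i)) (c l)%:R)^-1 : R)%:E < 1 ->
  exists sigma : nat -> V,
    (forall k, sigma k \in S (mkseq sigma k)) /\
    forall i, mkseq sigma (size (p i)) <> p i.
Proof.
move=> cS mass1.
have t0 : total_mass [::] < 1.
  apply: le_lt_trans mass1; apply: lee_nneseries => [i _ _|i _].
    by rewrite lee_fin mass_ge0.
  rewrite lee_fin /mass prefix0s prefixs0; case: eqP => // ->.
  by rewrite big_geq// invr1.
have V0 : V by have := leq_trans (c_gt0 _) (cS [::]) => /card_gt0P/cid[].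
have h w : exists a, total_mass w < 1 -> a \in S w /\ total_mass (rcons w a) < 1.
  have [w1|w1] := pselect (total_mass w < 1); last by exists V0.
  by have [a aS a1] := total_mass_step (cS w) w1; exists a.
have [next nextP] := choice h.
(* [P k] is the initial segment of length k of the branch, with total mass kept below 1. *)
pose P := fix P k := if k is k'.+1 then rcons (P k') (next (P k')) else [::].
pose sigma k := next (P k).
have PE k : P k = mkseq sigma k.
  by elim: k => //= k IH; rewrite /mkseq -addn1 iotaD map_cat /= -/(mkseq sigma k) -IH add0n cats1.
have P1 k : total_mass (P k) < 1.
  by elim: k => [//|k IH] /=; apply: (nextP _ IH).2.
exists sigma; split=> [k|i pi].
  by rewrite -PE; apply: (nextP _ (P1 k)).1.
(* On a branch running through [p i], the term of index i alone would be 1. *)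
have := P1 (size (p i)); rewrite PE pi; apply/negP; rewrite -leNgt.
apply: le_trans (nneseries_lim_ge i.+1 _); last by move=> *; rewrite lee_fin mass_ge0.
rewrite big_nat_recr//= -[leLHS]add0e leeD ?sume_ge0//.
  by move=> *; rewrite lee_fin mass_ge0.
by rewrite /mass prefix_refl.
Qed.

End AvoidPrefixes.

(** * General facts on Hausdorff content, measure and dimension *)

Section HausdorffComparison.
Variables (R : realType) (T : Type) (d : T -> T -> R).
Hypothesis d_ge0 : forall x y, 0 <= d x y.
Implicit Types (E U : set T) (s : R).
Local Open Scope ereal_scope.

Lemma hausdorff_gauge_ge0 s U : 0 <= hausdorff_gauge d s U.
Proof. by rewrite /hausdorff_gauge; case: ifP => // _; exact: poweR_ge0. Qed.

Lemma hausdorff_content_ge0 s delta E : 0 <= hausdorff_content d s delta E.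
Proof.
apply: le_ereal_inf_tmp => _ [U _ <-]; apply: nneseries_ge0 => *.
exact: hausdorff_gauge_ge0.
Qed.

Lemma le_hausdorff_content s delta E1 E2 : E1 `<=` E2 ->
  hausdorff_content d s delta E1 <= hausdorff_content d s delta E2.
Proof.
move=> E12; apply: ereal_inf_le_tmp => _ [U [EU Ud] <-]; exists U => //.
by split=> //; exact: subset_trans EU.
Qed.

Lemma hausdorff_content_le_measure s delta E : (0 < delta)%R ->
  hausdorff_content d s delta E <= hausdorff_measure d s E.
Proof. by move=> d0; apply: ereal_sup_ubound; exists delta. Qed.

Lemma hausdorff_measure_eq0 s E :
  (forall delta, (0 < delta)%R -> hausdorff_content d s delta E = 0) ->
  hausdorff_measure d s E = 0.
Proof.
move=> E0; apply/eqP; rewrite eq_le; apply/andP; split.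
  by apply: ge_ereal_sup => _ [delta d0 <-]; rewrite E0.
by rewrite -(E0 1%R ltr01); exact: hausdorff_content_le_measure.
Qed.

Lemma hausdorff_measure0_content s E delta : (0 < delta)%R ->
  hausdorff_measure d s E = 0 -> hausdorff_content d s delta E = 0.
Proof.
move=> d0 E0; apply/eqP; rewrite eq_le hausdorff_content_ge0 andbT -E0.
exact: hausdorff_content_le_measure.
Qed.

Lemma le_hausdorff_dim E1 E2 : E1 `<=` E2 -> hausdorff_dim d E1 <= hausdorff_dim d E2.
Proof.
move=> E12; apply: ereal_inf_le_tmp => _ [s [s0 Es] <-]; exists s => //; split=> //.
apply: hausdorff_measure_eq0 => delta d0; apply/eqP.
rewrite eq_le hausdorff_content_ge0 andbT -(hausdorff_measure0_content d0 Es).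
exact: le_hausdorff_content.
Qed.

Lemma diam_fin U delta : U !=set0 -> diam d U <= delta%:E ->
  exists r : R, [/\ (0 <= r)%R, (r <= delta)%R, diam d U = r%:E &
    forall x y, U x -> U y -> (d x y <= r)%R].
Proof.
move=> [x Ux] Ud.
have ge x' y' : U x' -> U y' -> (d x' y')%:E <= diam d U.
  by move=> Ux' Uy'; apply: ereal_sup_ubound; exists x' => //; exists y'.
move: Ud ge; case: (diam d U) => [r|//|] rd ge; last by have := ge _ _ Ux Ux.
rewrite lee_fin in rd; exists r; split=> //.
  by have := ge _ _ Ux Ux; rewrite lee_fin; exact: le_trans.
Qed.

Lemma hausdorff_gaugeE s U r : U !=set0 -> diam d U = r%:E ->
  hausdorff_gauge d s U = (r `^ s)%:E.
Proof. by move=> /set0P/negPf U0 Ur; rewrite /hausdorff_gauge U0 Ur poweR_EFin. Qed.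

Lemma hausdorff_gauge_anti s t U : (0 <= s)%R -> (s <= t)%R -> diam d U <= 1 ->
  hausdorff_gauge d t U <= hausdorff_gauge d s U.
Proof.
move=> s0 st U1; have [->|/set0P U0] := eqVneq U set0.
  by rewrite /hausdorff_gauge eqxx.
have [r [r0 r1 rE _]] := diam_fin U0 U1.
rewrite !(hausdorff_gaugeE _ U0 rE) lee_fin.
have [r_eq0|rn0] := eqVneq r 0%R; last by apply: ger_powR => //; rewrite lt0r rn0 r0.
rewrite r_eq0; have [t_eq0|tn0] := eqVneq t 0%R; last by rewrite powR0// powR_ge0.
by have -> : s = t by lra.
Qed.

(** On sets of diameter at most 1 the gauge decreases with the exponent, so a positive content at t
    stays positive at every s < t, and the measure at s cannot vanish. *)
Lemma hausdorff_dim_ge t E delta : (0 < delta <= 1)%R ->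
  0 < hausdorff_content d t delta E -> t%:E <= hausdorff_dim d E.
Proof.
move=> /andP[d0 d1] tE; apply: le_ereal_inf_tmp => _ [s [s0 Es] <-].
rewrite leNgt lte_fin; apply/negP => st.
move: tE; rewrite ltNge => /negP; apply.
rewrite -(hausdorff_measure0_content d0 Es).
apply: le_ereal_inf_tmp => _ [U [EU Ud] <-].
apply: ge_ereal_inf; exists (\sum_(0 <= i <oo) hausdorff_gauge d t (U i)).
  by exists U.
apply: lee_nneseries => [i _ _|i _]; first exact: hausdorff_gauge_ge0.
by apply: hausdorff_gauge_anti => //; [exact: ltW|exact: le_trans (Ud i) _].
Qed.

End HausdorffComparison.

(** * Small powers of q, and counting points on affine hyperplanes *)

Lemma expz_small (R : realType) (F : finFieldType) (e : R) : 0 < e ->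
  exists k : nat, (#|F|%:R : R) ^ (- k%:Z) < e.
Proof.
move=> e0; exists (Num.bound e^-1).
rewrite -invr_expz invf_plt ?posrE ?exprz_gt0 ?card_field_gt0//.
apply: (lt_le_trans (archi_boundP _)); first by rewrite invr_ge0 ltW.
rewrite -exprnP -natrX ler_nat ltnW// ltn_expl//; exact: card_finNzRing_gt1.
Qed.

Lemma powR_small (R : realType) (F : finFieldType) (a delta e : R) :
  0 < a -> 0 < delta -> 0 < e ->
  exists k : nat, (#|F|%:R : R) ^ (- k%:Z) <= delta /\
    (#|F|%:R : R) `^ (- (k%:R * a)) <= e.
Proof.
move=> a0 d0 e0; have q0 := card_field_gt0 R F.
have m0 : 0 < Num.min delta (e `^ a^-1) by rewrite lt_min d0 powR_gt0.
have [k] := expz_small F m0.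
rewrite lt_min => /andP[/ltW kd /ltW ke]; exists k; split=> //.
rewrite -mulNr powRrM.
have -> : - k%:R = (- k%:Z)%:~R :> R by rewrite mulrNz.
rewrite powR_intmul ?(ltW q0)//.
apply: le_trans (ge0_ler_powR (ltW a0) _ _ ke) _; rewrite ?nnegrE ?exprz_ge0 ?powR_ge0 ?(ltW q0)//.
by rewrite -powRrM mulVf ?gt_eqF// powRr1// ltW.
Qed.

Lemma vdist_ge0 (R : realType) (F : finFieldType) n (v w : 'cV[laurent F]_n) :
  0 <= vdist R v w.
Proof. exact: bigmax_ge_id. Qed.

(** Choose i0 with u_i0 nonzero. Correcting coordinate i0 moves v onto the hyperplane; together with
    the old value of v_i0 this determines v. Hence q^n <= |S| q. *)
Lemma card_affine_hyperplane (F : finFieldType) (n : nat) (u : 'cV[F]_n) (b : F) :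
  u != 0 -> (#|F| ^ n.-1 <= #|[set v : 'cV[F]_n | (\sum_i u i 0 * v i 0 == b)%R]%SET|)%N.
Proof.
move=> u0; have [i0 ui0] : exists i, u i 0 != 0.
  apply: contrapT => h; move/eqP: u0; apply; apply/matrixP => i j; rewrite ord1 mxE.
  by apply/eqP/negPn/negP => ui; apply: h; exists i.
set S := [set v | _]%SET.
pose f (v : 'cV[F]_n) :=
  (v + ((b - \sum_i u i 0 * v i 0) / u i0 0) *: delta_mx i0 0, v i0 0).
have finj : injective f.
  move=> v w [vw vw0]; apply/matrixP => i j; rewrite ord1.
  have [->//|ii0] := eqVneq i i0.
  by move/matrixP/(_ i 0): vw; rewrite !mxE (negPf ii0) !mulr0 !addr0.
have fS v : f v \in finset.setX S finset.setT.
  rewrite !inE andbT /f /= (eq_bigr (fun i => u i 0 * v i 0 +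
    (if i == i0 then b - \sum_i u i 0 * v i 0 else 0))) => [|i _].
    by rewrite big_split /= -big_mkcond big_pred1_eq addrC subrK.
  rewrite !mxE eqxx andbT mulrDr; congr (_ + _).
  by case: eqVneq => [->|_]; rewrite ?mulr1 ?mulr0// mulrC divfK.
have : (#|f @: finset.setT|%SET <= #|finset.setX S [set: F]%SET|)%N.
  by apply: subset_leq_card; apply/fintype.subsetP => _ /imsetP[v _ ->].
rewrite card_imset// cardsX !cardsT card_mx muln1.
rewrite -{1}(prednK (leq_ltn_trans (leq0n _) (ltn_ord i0))) expnSr leq_pmul2r//.
by apply/card_gt0P; exists 0.
Qed.

(** * Points of the unit cube as digit sequences *)

Section Digits.
Variables (R : realType) (F : finFieldType) (n : nat).
Implicit Types (theta : 'cV[laurent F]_n).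

Local Notation q := (#|F|%:R : R).

Definition digit theta (l : nat) : 'cV[F]_n := \col_i theta i 0 (Negz l).

Lemma digit_bounded (f : nat -> F) :
  exists N : int, forall k, N < k -> (if k is Negz l then f l else 0) = 0.
Proof. by exists (Negz 0) => -[l|l]. Qed.

Definition of_digits (sigma : nat -> 'cV[F]_n) : 'cV[laurent F]_n :=
  \col_i Laurent (digit_bounded (fun l => sigma l i 0)).

Lemma digit_of_digits sigma : digit (of_digits sigma) = sigma.
Proof. by apply/funext => l; apply/matrixP => i j; rewrite ord1 !mxE. Qed.

Lemma unit_cubeP theta : unit_cube R theta <-> forall i, deg_le (Negz 0) (theta i 0).
Proof.
by split=> h i; [apply: (elimT (lnorm_ltP R _ 0)) | apply: (introT (lnorm_ltP R _ 0))];
  have := h i; rewrite /= ?expr0z.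
Qed.

Lemma unit_cube_of_digits sigma : unit_cube R (of_digits sigma).
Proof. by apply/unit_cubeP => i; rewrite mxE => -[l|l]. Qed.

(** Together with [digits_vdist_lt], this identifies the open balls of radius q^(-k) in the unit
    cube with the cylinders of depth k. *)
Lemma vdist_lt_digits theta1 theta2 k :
  vdist R theta1 theta2 < q ^ (- k%:Z) -> mkseq (digit theta1) k = mkseq (digit theta2) k.
Proof.
move=> /vnorm_ltP h; apply/eq_in_map => l; rewrite mem_iota /= add0n => lk.
apply/matrixP => i j; rewrite ord1 !mxE.
have := h i (Negz l); rewrite !mxE lcoefD lcoefN => /(_ _)/eqP.
by rewrite subr_eq0 => /(_ _)/eqP; apply; lia.
Qed.

Lemma digits_vdist_lt theta1 theta2 k : unit_cube R theta1 -> unit_cube R theta2 ->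
  mkseq (digit theta1) k = mkseq (digit theta2) k ->
  vdist R theta1 theta2 < q ^ (- k%:Z).
Proof.
move=> /unit_cubeP c1 /unit_cubeP c2 h; apply/vnorm_ltP => i -[l|l] lk.
  by rewrite !mxE lcoefD lcoefN c1// c2// subrr.
have {}lk : (l < k)%N by lia.
move/(congr1 (fun s => nth 0 s l)): h; rewrite !nth_mkseq// => /matrixP/(_ i 0).
by rewrite !mxE lcoefD lcoefN => ->; rewrite subrr.
Qed.

Lemma pvec_dot_digits (y : 'cV[{poly F}]_n) theta (d : nat) :
  unit_cube R theta -> (vsize y <= d.+1)%N ->
  ((pvec y)^T *m theta) 0 0 (Negz 0) =
  \sum_(k < d.+1) \sum_i (y i 0)`_k * digit theta k i 0.
Proof.
move=> /unit_cubeP cube /vsize_leP yd.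
rewrite mxE lcoef_sum exchange_big /=; apply: eq_bigr => i _.
have -> : (pvec y)^T 0 i = laurent_of_poly (y i 0) by rewrite !mxE.
rewrite [LHS](lcoef_poly_mul (yd i) (cube i)).
by apply: eq_bigr => k _; rewrite !mxE.
Qed.

End Digits.

(** * Lower bound for the dimension of the set of solutions *)

Section Dimension.
Variables (R : realType) (F : finFieldType) (n L : nat).
Hypotheses (n_gt0 : (0 < n)%N) (L_gt1 : (1 < L)%N).
Variable y : nat -> 'cV[{poly F}]_n.
Hypothesis y_window : forall j, (j * L < vsize (y j) <= j.+1 * L)%N.

Local Notation q := (#|F|%:R : R).

(* The equation attached to the window of l fixes one of the n digits at level l
   exactly when y (l %/ L) has degree l. *)
Definition constrained l := vsize (y (l %/ L)) == l.+1.

Definition choices l : nat := (#|F| ^ (n - constrained l))%N.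

(** The equation of y_j involves only the digits up to the degree of y_j. It is imposed when the
    last of them is chosen, the earlier ones being read off w. *)
Definition children (w : seq 'cV[F]_n) : {set 'cV[F]_n} :=
  let l := size w in
  [set v : 'cV[F]_n | constrained l ==>
    (\sum_(k < l.+1) \sum_i (y (l %/ L) i 0)`_k * (rcons w v)`_k i 0 == 1)%R]%SET.

Lemma choices_gt0 l : (0 < choices l)%N.
Proof. by rewrite expn_gt0 ltnW// card_finNzRing_gt1. Qed.

Lemma choices_le_children w : (choices (size w) <= #|children w|)%N.
Proof.
rewrite /choices /children; set l := size w; set j := (l %/ L)%N.
have [cl|_] /= := boolP (constrained l); last first.
  by rewrite subn0 (_ : [set v | _]%SET = [set: 'cV[F]_n]%SET) ?cardsT ?card_mx ?muln1//.
(* The leading coefficients of y_j: some coordinate attains the maximal size l+1, so u is nonzero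
   and the admissible digits form an affine hyperplane. *)
pose u : 'cV[F]_n := \col_i (y j i 0)`_l.
have u0 : u != 0.
  have [|i iE] := @bigop.eq_bigmax 'I_n (fun i => size (y j i 0)); first by rewrite card_ord.
  have {iE} : size (y j i 0) = l.+1 by rewrite -iE; exact/eqP.
  move=> si; apply/eqP => /matrixP/(_ i 0); rewrite !mxE => yl.
  have := lead_coef_eq0 (y j i 0); rewrite lead_coefE si yl eqxx => /esym/eqP y0.
  by rewrite y0 size_poly0 in si.
pose b := 1 - \sum_(k < l) \sum_i (y j i 0)`_k * w`_k i 0.
rewrite subn1; apply: leq_trans (card_affine_hyperplane b u0) _.
apply: subset_leq_card; apply/fintype.subsetP => v; rewrite !inE => /eqP vb.
rewrite big_ord_recr /= nth_rcons ltnn eqxx.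
rewrite (eq_bigr (fun k : 'I_l => \sum_i (y j i 0)`_k * w`_k i 0)) => [|k _].
  have -> : \sum_i (y j i 0)`_l * v i 0 = b.
    by rewrite -vb; apply: eq_bigr => i _; rewrite mxE.
  by rewrite /b subrKC.
by apply: eq_bigr => i _; rewrite nth_rcons ltn_ord.
Qed.

Lemma of_digits_dual_bad (sigma : nat -> 'cV[F]_n) :
  (forall k, sigma k \in children (mkseq sigma k)) -> dual_bad R y (of_digits sigma).
Proof.
move=> sigmaP; split=> [|j]; first exact: unit_cube_of_digits.
have /andP[yl yr] := y_window j.
(* The degree of y_j lies in window j, so the condition at level l is exactly the equation of index
   j. *)
pose l := (vsize (y j)).-1.
have lE : vsize (y j) = l.+1 by rewrite /l prednK//; exact: leq_ltn_trans yl.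
have lj : (l %/ L = j)%N.
  have L0 : (0 < L)%N by exact: ltnW.
  by apply/eqP; rewrite eqn_leq -ltnS ltn_divLR// leq_divRL//; lia.
rewrite (@pvec_dot_digits R _ _ _ _ l) ?lE//; last exact: unit_cube_of_digits.
have := sigmaP l; rewrite inE /constrained size_mkseq lj lE eqxx /= => /eqP <-.
rewrite digit_of_digits; apply: eq_bigr => k _; apply: eq_bigr => i _.
by rewrite -mkseqS nth_mkseq.
Qed.

(** The added exponent counts the constrained levels below k: one for each completed window, and one
    more if the degree of y in the current window is below k. *)
Lemma prod_choices k :
  (\prod_(0 <= l < k) choices l * #|F| ^ (k %/ L + (vsize (y (k %/ L)) <= k)) =
   #|F| ^ (n * k))%N.
Proof.
have L0 : (0 < L)%N by exact: ltnW.
elim: k => [|k IH].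
  by rewrite big_geq// div0n leqNgt; have /andP[-> _] := y_window 0%N; rewrite muln0.
have -> : (k.+1 %/ L + (vsize (y (k.+1 %/ L)) <= k.+1) =
   k %/ L + (vsize (y (k %/ L)) <= k) + constrained k)%N.
  rewrite /constrained divnS//; set a := (k %/ L)%N.
  have /andP[_ ya] := y_window a; have := divn_eq k.+1 L; rewrite divnS// -/a.
  (* When a new window starts at k+1, the quotient grows by 1 and the indicator restarts at 0,
     because the new y has size greater than k+1. *)
  case: (boolP (L %| k.+1)%N) => [/eqP -> ka|_ _]; last first.
    by rewrite add0n -addnA; congr addn; case: ltngtP (leqVgt (vsize (y a)) k); lia.
  have /andP[yb _] := y_window (1 + a).
  move: yb ka; rewrite addn0 !add1n => yb ka.
  by lia.
rewrite big_nat_recr//= expnD [choices k]/choices mulnACA IH -expnD subnK.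
  by rewrite -expnD mulnS addnC.
by case: constrained.
Qed.

(** At most 1 + k/L levels below k are constrained, the 1 accounting for the unfinished window. *)
Lemma prod_choices_inv_le k :
  (\prod_(0 <= l < k) (choices l)%:R)^-1 <= q `^ (1 - k%:R * (n%:R - L%:R^-1)).
Proof.
have q0 := card_field_gt0 R F; have q1 := card_field_gt1 R F.
have L0 : (0 < L%:R :> R) by rewrite ltr0n ltnW.
set r := (k %/ L + (vsize (y (k %/ L)) <= k))%N.
have rk : r%:R <= 1 + k%:R / L%:R :> R.
  rewrite addrC /r natrD lerD//; last by rewrite lern1 leq_b1.
  by rewrite ler_pdivlMr// -natrM ler_nat leq_divM.
have -> : (\prod_(0 <= l < k) (choices l)%:R)^-1 = q `^ (r%:R - (n * k)%:R).
  rewrite powRD; last by rewrite (gt_eqF q0) implybT.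
  rewrite powRN !powR_mulrn ?(ltW q0)//.
  rewrite -[q ^+ (n * k)]natrX -prod_choices natrM natr_prod natrX invfM.
  by rewrite mulrC mulfVK// expf_neq0// gt_eqF.
apply: ler_powR; first exact: ltW.
by rewrite natrM mulrBr; lra.
Qed.

Local Notation dim := (n%:R - L%:R^-1 : R).

Lemma dim_gt0 : 0 < dim.
Proof.
rewrite subr_gt0 (@lt_le_trans _ _ 1)// ?ler1n// invf_lt1 ?ltr1n//.
by rewrite ltr0n ltnW.
Qed.

Lemma scale_bracket (r : R) : 0 < r < 1 ->
  exists k : nat, q ^ (- k.+1%:Z) <= r < q ^ (- k%:Z).
Proof.
move=> /andP[r0 r1]; have hex : exists k : nat, q ^ (- k%:Z) <= r.
  by have [k /ltW kr] := expz_small F r0; exists k.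
case: (ex_minnP hex) => -[|k] kr kmin; first by rewrite expr0z leNgt r1 in kr.
exists k; rewrite kr ltNge; apply/negP => /kmin.
by rewrite ltnn.
Qed.

(** If the diameter r satisfies q^(-j-1) <= r < q^(-j), then U lies in a cylinder of depth j, of
    mass at most q^(1 - j dim) <= q^(1 + dim) r^dim. Sets that are empty or of diameter 0 have no
    such j; they get a cylinder deep enough to have mass at most e. *)
Lemma cylinder_cover (U : set 'cV[laurent F]_n) (e : R) : 0 < e ->
  (diam (@vdist R F n) U <= (2^-1)%:E)%E ->
  exists p : seq 'cV[F]_n,
    (forall theta, U theta -> mkseq (digit theta) (size p) = p) /\
    (((\prod_(0 <= l < size p) (choices l)%:R)^-1)%:E <=
      (q `^ (1 + dim))%:E * hausdorff_gauge (@vdist R F n) dim U + e%:E)%E.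
Proof.
move=> e0 U2; have q0 := card_field_gt0 R F; have q1 := card_field_gt1 R F.
have d0 := dim_gt0.
have [k ke] : exists k : nat, q `^ (1 - k%:R * dim) <= e.
  have [k [_ ke]] := powR_small F d0 ltr01 (divr_gt0 e0 q0); exists k.
  rewrite powRD; last by rewrite (gt_eqF q0) implybT.
  by rewrite powRr1 ?(ltW q0)// mulrC -ler_pdivlMr.
have deep : (((\prod_(0 <= l < k) (choices l)%:R)^-1)%:E <=
    (q `^ (1 + dim))%:E * hausdorff_gauge (@vdist R F n) dim U + e%:E)%E.
  rewrite -[leLHS]add0e leeD ?mule_ge0 ?hausdorff_gauge_ge0 ?lee_fin ?powR_ge0//.
  exact: le_trans (prod_choices_inv_le k) ke.
have [U_eq0|/set0P U0] := eqVneq U set0.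
  exists (nseq k 0); split=> [theta|]; first by rewrite U_eq0.
  by rewrite size_nseq.
have [theta0 Ut0] := U0.
have [r [r0 r2 rE rU]] := diam_fin (@vdist_ge0 R F n) U0 U2.
have [r_eq0|rn0] := eqVneq r 0.
  exists (mkseq (digit theta0) k); rewrite size_mkseq; split=> // theta Ut.
  by apply: (@vdist_lt_digits R); rewrite (le_lt_trans (rU _ _ Ut Ut0))// r_eq0 exprz_gt0.
have r01 : 0 < r < 1 by rewrite lt0r rn0 r0 /=; lra.
have [j /andP[jr rj]] := scale_bracket r01.
exists (mkseq (digit theta0) j); rewrite size_mkseq; split=> [theta Ut|].
  by apply: (@vdist_lt_digits R); exact: le_lt_trans (rU _ _ Ut Ut0) rj.
rewrite (hausdorff_gaugeE _ U0 rE) -EFinM -EFinD lee_fin.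
apply: (le_trans (prod_choices_inv_le j)); rewrite -[leLHS]addr0 lerD ?(ltW e0)//.
have -> : 1 - j%:R * dim = 1 + dim + (- j.+1%:Z)%:~R * dim.
  by rewrite mulrNz -[j.+1]addn1 PoszD mulrzDr /=; lra.
rewrite powRD; last by rewrite (gt_eqF q0) implybT.
rewrite ler_wpM2l ?powR_ge0// powRrM powR_intmul ?(ltW q0)//.
by apply: ge0_ler_powR; rewrite ?nnegrE ?exprz_ge0 ?(ltW q0) ?(ltW d0).
Qed.

Lemma dual_bad_dim : (dim%:E <= hausdorff_dim (@vdist R F n) (dual_bad R y))%E.
Proof.
have q0 := card_field_gt0 R F.
have C0 : 0 < q `^ (1 + dim) by exact: powR_gt0.
apply: (@hausdorff_dim_ge _ _ _ (@vdist_ge0 R F n) _ _ 2^-1).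
  by rewrite invr_gt0 ltr0n /= invf_le1 ?ler1n.
(* A cover of total gauge below this constant yields cylinders whose main terms add up to less than
   1/2; the errors e_i = 2^-(i+2) add up to 1/2. *)
have c0 : 0 < 2^-1 / q `^ (1 + dim) by rewrite divr_gt0 ?invr_gt0.
apply: (@lt_le_trans _ _ (2^-1 / q `^ (1 + dim))%:E); first by rewrite lte_fin.
apply: le_ereal_inf_tmp => _ [U [KU U2] <-]; rewrite leNgt; apply/negP => Usmall.
have e0 i : 0 < 2^-1 / (2 ^ i.+1)%:R :> R by rewrite divr_gt0 ?ltr0n ?expn_gt0.
have [p pP] := choice (fun i => cylinder_cover (e0 i) (U2 i)).
have [|sigma [sigmaS sigmaP]] := @avoid_prefixes R _ _ choices_gt0 p children choices_le_children.
  apply: (@le_lt_trans _ _ (\sum_(0 <= i <oo) ((q `^ (1 + dim))%:E *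
      hausdorff_gauge (@vdist R F n) dim (U i) + (2^-1 / (2 ^ i.+1)%:R)%:E))%E).
    apply: lee_nneseries => [i _ _|i _]; last exact: (pP i).2.
    by rewrite lee_fin invr_ge0 prodr_ge0.
  have g0 i : (0 <= (q `^ (1 + dim))%:E * hausdorff_gauge (@vdist R F n) dim (U i))%E.
    by rewrite mule_ge0 ?hausdorff_gauge_ge0 ?lee_fin ?powR_ge0.
  apply: (le_lt_trans (epsilon_trick _ g0 _)); first by rewrite invr_ge0.
  rewrite nneseriesZl => [|i _]; last exact: hausdorff_gauge_ge0.
  have -> : 1%E = ((2^-1)%:E + (2^-1)%:E)%E :> \bar R by rewrite -EFinD; congr EFin; lra.
  by rewrite lteD2rE// -lte_pdivlMl// -EFinM mulrC.
have sK := of_digits_dual_bad sigmaS.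
have [i _ Ui] := KU _ sK.
by apply: (sigmaP i); have := (pP i).1 _ Ui; rewrite digit_of_digits.
Qed.

End Dimension.

(** * Upper bound: the unit cube has dimension at most n *)

Section UpperBound.
Variables (R : realType) (F : finFieldType) (n : nat).

Local Notation q := (#|F|%:R : R).
Local Notation d := (@vdist R F n).

Definition prefixes k : seq (seq 'cV[F]_n) := [seq val t | t <- enum {: k.-tuple 'cV[F]_n}].

Lemma size_prefixes k : size (prefixes k) = (#|F| ^ (n * k))%N.
Proof. by rewrite size_map -cardE card_tuple card_mx muln1 expnM. Qed.

(** Covers are infinite sequences, so every natural i is allowed; indices past the number of words
    give the empty set, of gauge 0. *)
Definition cylinder k i : set 'cV[laurent F]_n :=
  [set theta | [/\ unit_cube R theta, (i < size (prefixes k))%N &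
                   mkseq (digit theta) k = nth [::] (prefixes k) i]].

Lemma cylinder_bigcup k : @unit_cube R F n `<=` \bigcup_i cylinder k i.
Proof.
move=> theta cube; exists (index (mkseq (digit theta) k) (prefixes k)) => //.
have kin : mkseq (digit theta) k \in prefixes k.
  have kt : size (mkseq (digit theta) k) == k by rewrite size_mkseq.
  by apply/mapP; exists (Tuple kt); rewrite ?mem_enum.
by split=> //; rewrite ?index_mem ?nth_index.
Qed.

Lemma cylinder_diam k i : (diam d (cylinder k i) <= (q ^ (- k%:Z))%:E)%E.
Proof.
apply: ge_ereal_sup => _ [v [v1 _ vi]] [w [w1 _ wi] <-].
by rewrite lee_fin ltW// digits_vdist_lt// vi wi.
Qed.

Lemma cylinder_gauge s k i : 0 <= s ->
  (hausdorff_gauge d s (cylinder k i) <= (q `^ (- (k%:R * s)))%:E)%E.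
Proof.
move=> s0; have q0 := card_field_gt0 R F.
have [->|/set0P U0] := eqVneq (cylinder k i) set0.
  by rewrite /hausdorff_gauge eqxx lee_fin powR_ge0.
have [r [r0 rq rE _]] := diam_fin (@vdist_ge0 R F n) U0 (cylinder_diam k i).
rewrite (hausdorff_gaugeE _ U0 rE) lee_fin -mulNr powRrM.
have -> : - k%:R = (- k%:Z)%:~R :> R by rewrite mulrNz.
by rewrite powR_intmul ?(ltW q0)// ge0_ler_powR// nnegrE exprz_ge0// ltW.
Qed.

(** The q^(n k) cylinders of depth k have gauge at most q^(-k s) each, in total q^(-k (s - n)),
    which is arbitrarily small for large k. *)
Lemma unit_cube_content s delta : n%:R < s -> 0 < delta ->
  hausdorff_content d s delta (@unit_cube R F n) = 0%E.
Proof.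
move=> ns d0; have s0 : 0 <= s by apply: le_trans (ltW ns).
have q0 := card_field_gt0 R F.
apply/eqP; rewrite eq_le hausdorff_content_ge0 andbT.
apply/lee_addgt0Pr => e e0; rewrite add0e.
have sn0 : 0 < s - n%:R by rewrite subr_gt0.
have [k [kd ke]] := powR_small F sn0 d0 e0.
apply: ge_ereal_inf; exists (\sum_(0 <= i <oo) hausdorff_gauge d s (cylinder k i))%E.
  exists (cylinder k) => //; split; first exact: cylinder_bigcup.
  by move=> i; apply: le_trans (cylinder_diam k i) _; rewrite lee_fin.
rewrite (nneseries_split 0 (size (prefixes k))) => [|*]; last exact: hausdorff_gauge_ge0.
rewrite eseries0 => [|i ik _]; last first.
  rewrite /hausdorff_gauge (_ : cylinder k i = set0) ?eqxx//.
  by rewrite -subset0 => v [_ +]; rewrite ltnNge ik.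
rewrite adde0 add0n.
apply: (@le_trans _ _ (\sum_(0 <= i < size (prefixes k)) (q `^ (- (k%:R * s)))%:E)%E).
  by apply: lee_sum => i _; exact: cylinder_gauge.
rewrite sumEFin lee_fin sumr_const_nat subn0 size_prefixes -[leLHS]mulr_natl natrX.
rewrite -powR_mulrn ?(ltW q0)// -powRD; last by rewrite (gt_eqF q0) implybT.
by rewrite (_ : _ + _ = - (k%:R * (s - n%:R)))//; rewrite natrM; ring.
Qed.

Lemma unit_cube_dim : (hausdorff_dim d (@unit_cube R F n) <= n%:R%:E)%E.
Proof.
apply/lee_addgt0Pr => e e0; rewrite -EFinD.
apply: ereal_inf_lbound; exists (n%:R + e) => //; split.
  by rewrite /= addr_ge0// ltW.
apply: hausdorff_measure_eq0 => delta d0.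
by apply: unit_cube_content; rewrite ?ltrDl.
Qed.

End UpperBound.

(** * Dimension of Bad(A) *)

Section Bad.
Variables (R : realType) (F : finFieldType) (m n : nat).
Hypotheses (m_gt0 : (0 < m)%N) (n_gt0 : (0 < n)%N).
Variable A : 'M[laurent F]_(n, m).

Local Notation q := (#|F|%:R : R).
Local Notation d := (@vdist R F n).

Lemma hausdorff_dim_bad_eps K : (1 < m * K)%N ->
  ((n%:R - (m * K)%:R^-1)%:E <=
   hausdorff_dim d (bad_eps A (q `^ (- (m%:R / n%:R) - (m * K)%:R))))%E.
Proof.
move=> mK; have /andP[_ K0] : (0 < m)%N && (0 < K)%N by rewrite -muln_gt0 ltnW.
have [y [yw yb]] := window_minimizers R A n_gt0 (ltnW mK).
apply: le_trans (dual_bad_dim R n_gt0 mK yw) _.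
apply: le_hausdorff_dim.
by apply: dual_bad_sub => // j; case/andP: (yw j).
Qed.

Lemma le_bad_eps e1 e2 : e1 <= e2 -> bad_eps (R := R) A e2 `<=` bad_eps A e1.
Proof.
by move=> e12 theta [cube e2l]; split=> //; apply: le_trans e2l; rewrite lee_fin.
Qed.

Lemma hausdorff_dim_bad : hausdorff_dim d (bad R A) = n%:R%:E.
Proof.
apply/eqP; rewrite eq_le; apply/andP; split.
  apply: le_trans (unit_cube_dim R F n); apply: le_hausdorff_dim.
  by move=> theta [e _ []].
(* K exceeds 1/e, so that 1/(mK) <= e; the two successors ensure 1 < mK. *)
apply/lee_addgt0Pr => e e0; pose K := (Num.bound e^-1).+2.
have mK : (1 < m * K)%N by rewrite (leq_trans _ (leq_pmull _ m_gt0)).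
have Ke : (m * K)%:R^-1 <= e.
  rewrite invf_ple ?posrE ?ltr0n ?(ltnW mK)//.
  have : e^-1 < (Num.bound e^-1)%:R by apply: archi_boundP; rewrite invr_ge0 ltW.
  move=> /ltW/le_trans; apply.
  by rewrite ler_nat (leq_trans _ (leq_pmull _ m_gt0))// /K -addn2 leq_addr.
rewrite -leeBlDr// -EFinB; apply: (@le_trans _ _ (n%:R - (m * K)%:R^-1)%:E).
  by rewrite lee_fin lerB.
apply: le_trans (hausdorff_dim_bad_eps mK) _.
apply: le_hausdorff_dim.
move=> theta; exists (q `^ (- (m%:R / n%:R) - (m * K)%:R)) => //=.
by rewrite powR_gt0 ?card_field_gt0.
Qed.

End Bad.

(** * The function f and the quantitative bound *)

Section DimensionDefect.
Variables (R : realType) (q a C : R).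
Hypotheses (q_gt1 : 1 < q) (C_ge0 : 0 <= C).

(* With t = q^(-T - a) this is C / max(6, T); the value at 0 is set apart since ln 0 = 0. *)
Definition defect (t : R) : R :=
  if t <= 0 then 0 else C / Num.max 6 (- ln t / ln q - a).

Let max6_gt0 (x : R) : 0 < Num.max 6 x.
Proof. by rewrite lt_max ltr0n. Qed.

Lemma defect_ge0 t : 0 <= defect t.
Proof. by rewrite /defect; case: ifP => // _; rewrite divr_ge0// ltW. Qed.

Lemma defect0 : defect 0 = 0.
Proof. by rewrite /defect lexx. Qed.

Lemma continuous_defect : continuous defect.
Proof.
have lnq : 0 < ln q by rewrite ln_gt0.
move=> t; have [t0|t0|->] := ltgtP t 0.
- have h : \forall x \near t, 0 = defect x.
    near=> x; rewrite /defect ifT//; apply: ltW.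
    by near: x; exact: lt_nbhsl.
  rewrite /continuous_at -(nbhs_singleton h).
  by apply: cvg_trans (near_eq_cvg h) _; exact: cvg_cst.
- have h : \forall x \near t, C / Num.max 6 (- ln x / ln q - a) = defect x.
    near=> x; rewrite /defect ifF//; apply/negbTE; rewrite -ltNge.
    by near: x; exact: lt_nbhsr.
  rewrite /continuous_at -(nbhs_singleton h).
  apply: cvg_trans (near_eq_cvg h) _.
  apply: cvgM; first exact: cvg_cst.
  apply: cvgV; first by rewrite gt_eqF.
  have cl : {for t, continuous (fun x => - ln x / ln q - a)}.
    apply: cvgB; last exact: cvg_cst.
    apply: cvgM; last exact: cvg_cst.
    by apply: cvgN; exact: continuous_ln.
  exact: (continuous_max (f := fun=> 6)) (@cvg_cst _ _ _ _ _) cl.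
- rewrite /continuous_at defect0; apply/cvgrPdist_lt => e e0.
  (* Chosen so that C < e M. For 0 < x < q^(-(M + a)) the denominator is at least M, hence the value
     is below e. *)
  pose M := C / e + 1.
  have M0 : 0 < M by rewrite /M ltr_wpDl// divr_ge0// ltW.
  near=> x; rewrite sub0r normrN ger0_norm ?defect_ge0// /defect.
  case: ifPn => // x0; rewrite -ltNge in x0.
  have : x < expR (- (M + a) * ln q).
    by near: x; apply: lt_nbhsl; exact: expR_gt0.
  rewrite -ltr_ln ?posrE ?expR_gt0// expRK => lx.
  have Mx : M <= Num.max 6 (- ln x / ln q - a).
    rewrite le_max; apply/orP; right; rewrite lerBrDr ler_pdivlMr//.
    by rewrite lerNr -mulNr ltW.
  rewrite ltr_pdivrMr//; apply: (@lt_le_trans _ _ (e * M)); last by rewrite ler_pM2l.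
  by rewrite /M mulrDr mulr1 mulrC mulfVK ?gt_eqF// ltrDl.
Unshelve. all: by end_near.
Qed.

End DimensionDefect.

(** Write eps = q^(-a - T) with a = m/n; the bound on eps says T >= 6. With K the integer part of
    T/m, mK <= T gives eps <= q^(-a - mK), so the set for eps contains the one for window length mK,
    and the loss 1/(mK) is to be compared with 2mn/T. *)
Lemma bad_eps_dim_defect (R : realType) (F : finFieldType) (m n : nat)
    (A : 'M[laurent F]_(n, m)) (eps : R) :
  (0 < m)%N -> (0 < n)%N -> 0 < eps ->
  eps <= #|F|%:R `^ (- (m%:R / n%:R) - 6) ->
  ((n%:R - defect #|F|%:R (m%:R / n%:R) (2 * m * n)%:R eps)%:E <=
    hausdorff_dim (@vdist R F n) (bad_eps A eps))%E.
Proof.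
move=> m0 n0 e0 e6; have q0 := card_field_gt0 R F; have q1 := card_field_gt1 R F.
have lnq : 0 < ln (#|F|%:R : R) by rewrite ln_gt0.
have m1 : 1 <= m%:R :> R by rewrite ler1n.
have n1 : 1 <= n%:R :> R by rewrite ler1n.
set a : R := m%:R / n%:R in e6 *; rewrite /defect [eps <= 0]leNgt e0 /=.
set T := - ln eps / ln #|F|%:R - a.
have epsE : eps = #|F|%:R `^ (- a - T).
  rewrite /powR gt_eqF// (_ : (- a - T) * ln #|F|%:R = ln eps) ?lnK//.
  by rewrite /T; field; rewrite gt_eqF.
have T6 : 6 <= T.
  have : ln eps <= ln (#|F|%:R `^ (- a - 6)) by rewrite ler_ln ?posrE ?powR_gt0.
  by rewrite epsE !ln_powR ler_pM2r// lerD2l lerN2.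
rewrite (max_idPr T6); have T0 : 0 < T by lra.
(* For T < 2m the defect 2mn/T exceeds n, and a dimension is never negative. *)
have [Tm|mT] := ltP T (2 * m%:R).
  apply: (@le_trans _ _ 0%E).
    rewrite lee_fin subr_le0 ler_pdivlMr// !natrM; nra.
  by apply: le_ereal_inf_tmp => _ [s [s0 _] <-]; rewrite lee_fin.
pose K := Num.truncn (T / m%:R).
have /andP[KT TK] := truncn_itv (ltW (divr_gt0 T0 (lt_le_trans ltr01 m1))).
rewrite -/K in KT TK.
rewrite ler_pdivlMr ?ltr_pdivrMr// ?(lt_le_trans ltr01)// in KT TK.
have K2 : (1 < K)%N.
  by rewrite -ltnS -(ltr_nat R); nra.
have mK : (1 < m * K)%N by rewrite (leq_trans K2)// leq_pmull.
apply: (@le_trans _ _ (n%:R - (m * K)%:R^-1)%:E).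
  rewrite lee_fin lerB// ler_pdivlMr// mulrC ler_pdivrMr ?ltr0n ?(ltnW mK)//.
  have K1 : 1 <= K%:R :> R by rewrite ler1n ltnW.
  (* T < m (K+1) <= 2mK, since K >= 1. *)
  apply: (@le_trans _ _ (2 * (m * K)%:R)).
    by rewrite natrM; rewrite -natr1 in TK; nra.
  by rewrite ler_wpM2r// ler_nat -mulnA leq_pmulr// muln_gt0 m0.
apply: le_trans (hausdorff_dim_bad_eps R m0 n0 A mK) _.
apply: le_hausdorff_dim; apply: le_bad_eps.
by rewrite epsE; apply: ler_powR; rewrite ?(ltW q1)// lerD2l lerN2 natrM mulrC.
Qed.

Theorem theorem1p3 (R : realType) (F : finFieldType) (m n : nat)
    (m_gt0 : (0 < m)%N) (n_gt0 : (0 < n)%N) (A : 'M[laurent F]_(n, m)) :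
  hausdorff_dim (@vdist R F n) (bad R A) = n%:R%:E /\
  exists f : R -> R,
    [/\ {within `[0, +oo[, continuous f},
        (forall t, 0 <= t -> 0 <= f t),
        f 0 = 0 &
        forall eps : R, 0 < eps ->
          eps <= #|F|%:R `^ (- (m%:R / n%:R) - 6) ->
          ((n%:R - f eps)%:E <= hausdorff_dim (@vdist R F n) (bad_eps A eps))%E].
Proof.
split; first exact: hausdorff_dim_bad.
exists (defect #|F|%:R (m%:R / n%:R) (2 * m * n)%:R); split.
- apply: continuous_subspaceT; apply: continuous_defect => //.
  exact: card_field_gt1.
- by move=> t _; exact: defect_ge0.
- exact: defect0.
- by move=> eps e0 e6; exact: bad_eps_dim_defect.
Qed.
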